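(* For every $k > 0$ there is a constant $\varepsilon_k > 0$ such that every sufficiently large point set $P$ in the plane in general position contains $2k$ subsets $A_1,\ldots,A_k,B_1,\ldots,B_k$, each of size at least $\varepsilon_k|P|$, such that every segment that joins a point from $A_i$ and $B_{k+1-i}$ crosses every segment that joins a point from $A_{k+1-i}$ and $B_i$, for $1\le i\le k$. Moreover, $\varepsilon_k=\Omega(1/k^4)$.
   Context: Here $k$ is an integer and $P$ is a finite set. A point set in the plane is in general position if no three of its members are collinear. Two segments with endpoints in $P$ cross if their interiors intersect and they do not share a common endpoint. The notation $\varepsilon_k=\Omega(1/k^4)$ means that there is an absolute constant $c>0$ such that one can take $\varepsilon_k\ge c/k^4$.
   Formalization: The middle index i = k+1-i (k odd) is excluded from the crossing condition: there a segment joining A_i and B_i would have to cross itself, so the claim as written fails for every odd k (e.g. k = 1). The 2k subsets are also required to be pairwise disjoint, which is stronger. *)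

(* Defs.v *)
From mathcomp Require Import all_boot all_order all_algebra.
From mathcomp Require Import finmap reals.

Set Implicit Arguments.
Unset Strict Implicit.
Unset Printing Implicit Defensive.

Import Order.TTheory GRing.Theory Num.Theory.
Local Open Scope fset_scope.
Local Open Scope ring_scope.

Definition collinear (R : realType) (p q r : 'rV[R]_2) : Prop :=
  exists a v : 'rV[R]_2, v != 0 /\
    forall x, x \in [:: p; q; r] -> exists t : R, x = a + t *: v.

Definition general_position (R : realType) (P : {fset 'rV[R]_2}) : Prop :=
  forall p q r, p \in P -> q \in P -> r \in P ->
    p != q -> p != r -> q != r -> ~ collinear p q r.

(* Relative interior of the segment pq. *)
Definition open_segment (R : realType) (p q x : 'rV[R]_2) : Prop :=
  exists t : R, [/\ 0 < t, t < 1 & x = (1 - t) *: p + t *: q].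

(* The segments pq and rs cross. *)
Definition segments_cross (R : realType) (p q r s : 'rV[R]_2) : Prop :=
  (exists x, open_segment p q x /\ open_segment r s x) /\
  [/\ p != r, p != s, q != r & q != s].

(* The 2k sets A_i, B_i are pairwise disjoint. *)
Definition disjoint_families (R : realType) (k : nat)
    (A B : 'I_k -> {fset 'rV[R]_2}) : Prop :=
  [/\ forall i j, i != j -> [disjoint A i & A j],
      forall i j, i != j -> [disjoint B i & B j]
    & forall i j, [disjoint A i & B j]].

(* Indices are 0-based, so [rev_ord i] is the index written k+1-i with 1-based
   indices.  The case i = k+1-i (middle index, k odd) is excluded: there both
   segments range over the same set, so a segment would have to cross itself. *)
Definition reversed_segments_cross (R : realType) (k : nat)
    (A B : 'I_k -> {fset 'rV[R]_2}) : Prop :=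
  forall i : 'I_k, i != rev_ord i ->
  forall a b a' b', a \in A i -> b \in B (rev_ord i) ->
    a' \in A (rev_ord i) -> b' \in B i -> segments_cross a b a' b'.

(* Main.v *)
Require Import Defs.
From mathcomp Require Import all_boot all_order all_algebra.
From mathcomp Require Import finmap reals.
From mathcomp Require Import boolp ring lra zify.

Import Order.TTheory GRing.Theory Num.Theory.
Local Open Scope fset_scope.
Local Open Scope ring_scope.

(** The crossing condition only relates the index i to k+1-i, so it suffices to
    find k disjoint quadruples of linear-size sets (Q0,Q1,Q2,Q3) such that each
    segment between Q0 and Q1 crosses each segment between Q2 and Q3; this even
    gives eps_k = 1/(1280 k).  Cut P into k chunks of equal size and look for one
    quadruple in each chunk.  Cut a chunk into five vertical strips.  Given three
    strips, a line bisecting the outer two has half of the middle one on one side;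
    keeping opposite halves makes the orientation of the triples constant.  After
    doing this for seven triples of strips, each strip has kept 1/128 of its points
    and these orientations satisfy one of seven relations, each of which forces two
    of the segments spanned by four of the strips to cross. *)

(** * Orientation and sheared coordinates *)

(** Twice the signed area of the triangle [abc], positive for a counterclockwise turn. *)
Definition orient {R : realType} (a b c : 'rV[R]_2) : R :=
  (b 0 0 - a 0 0) * (c 0 1 - a 0 1) - (c 0 0 - a 0 0) * (b 0 1 - a 0 1).

(* A substitute for the x-coordinate: unlike the latter it is injective on a
   given finite set for a suitable [e], and it leaves [orient] unchanged. *)
Definition shear {R : realType} (e : R) (p : 'rV[R]_2) : R := p 0 0 + e * p 0 1.

(** In the coordinates ([shear e p], [p 0 1]), the level sets of [height e m] are the lines of slope
    [m]. *)
Definition height {R : realType} (e m : R) (p : 'rV[R]_2) : R :=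
  p 0 1 - m * shear e p.

Lemma row2P {R : realType} (p q : 'rV[R]_2) :
  p 0 0 = q 0 0 -> p 0 1 = q 0 1 -> p = q.
Proof.
move=> h0 h1; apply/rowP => -[[|[|//]] h].
- by rewrite (_ : Ordinal h = 0) //; apply/val_inj.
- by rewrite (_ : Ordinal h = 1) //; apply/val_inj.
Qed.

(** Passing to shear and height is a linear map of determinant 1. The three coefficients sum to
    zero, so only heights relative to a common level matter; for increasing shears the middle point
    alone enters negatively. *)
Lemma orient_heightE {R : realType} (e m : R) (a b c : 'rV[R]_2) :
  orient a b c =
    (shear e b - shear e a) * height e m c
    + (shear e c - shear e b) * height e m a
    - (shear e c - shear e a) * height e m b.
Proof. rewrite /orient /height /shear; ring. Qed.

Lemma orient_neq0 {R : realType} (P : {fset 'rV[R]_2}) (p q r : 'rV[R]_2) :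
  general_position P -> p \in P -> q \in P -> r \in P ->
  p != q -> p != r -> q != r -> orient p q r != 0.
Proof.
move=> gp pP qP rP pq pr qr; apply/eqP => o0.
apply: (gp p q r) => //; exists p, (q - p); split.
  by rewrite subr_eq0 eq_sym.
have [t tr] : exists t : R, r = p + t *: (q - p).
  (* Solve for [t] in a coordinate where [p] and [q] differ; the vanishing determinant settles the
     other one. *)
  have [x0|xN0] := eqVneq (q 0 0 - p 0 0) 0.
    have yN0 : q 0 1 - p 0 1 != 0.
      apply: contraNneq pq => y0; apply/eqP/row2P.
      - by apply/esym/eqP; rewrite -subr_eq0 x0.
      - by apply/esym/eqP; rewrite -subr_eq0 y0.
    exists ((r 0 1 - p 0 1) / (q 0 1 - p 0 1)).
    apply: row2P; rewrite !mxE.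
    - rewrite x0 mulr0 addr0; apply/eqP; rewrite -subr_eq0.
      move/eqP: o0; rewrite /orient x0 mul0r sub0r oppr_eq0 mulf_eq0.
      by rewrite (negbTE yN0) orbF.
    - by rewrite divfK // addrC subrK.
  exists ((r 0 0 - p 0 0) / (q 0 0 - p 0 0)).
  apply: row2P; rewrite !mxE.
  - by rewrite divfK // addrC subrK.
  - move/eqP: o0; rewrite /orient subr_eq0 => /eqP o0.
    by rewrite mulrAC -o0 mulrAC mulfV // mul1r addrC subrK.
move=> x; rewrite !inE => /or3P[]/eqP->.
- by exists 0; rewrite scale0r addr0.
- by exists 1; rewrite scale1r addrC subrK.
- by exists t.
Qed.

(** * Crossing criteria in terms of orientations *)

Lemma segments_crossC {R : realType} (a b c d : 'rV[R]_2) :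
  segments_cross a b c d -> segments_cross c d a b.
Proof.
move=> [[x [h1 h2]] [ac ad bc bd]]; split; first by exists x.
by split; rewrite eq_sym.
Qed.

(** The line through either segment strictly separates the endpoints of the other. *)
Lemma orient_cross {R : realType} (a b c d : 'rV[R]_2) :
  orient a b c * orient a b d < 0 -> orient c d a * orient c d b < 0 ->
  segments_cross a b c d.
Proof.
(* [x / (x - y)] is the zero of the affine function with values [x] at 0 and [y] at 1. *)
have ratio x y : x * y < 0 :> R -> [/\ x - y != 0, 0 < x / (x - y) & x / (x - y) < 1].
  move=> xy; have xyN : x - y != 0.
    by apply/eqP => h; move: xy; rewrite (_ : y = x) ?ltNge ?sqr_ge0 //; lra.
  split=> //.
    rewrite (_ : x / (x - y) = (x * (x - y)) / (x - y) ^+ 2); last by field.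
    apply: divr_gt0; last by rewrite exprn_even_gt0.
    by rewrite mulrBr; apply: ltr_wpDl; [exact: sqr_ge0 | rewrite oppr_gt0].
  rewrite -subr_gt0 (_ : 1 - x / (x - y) = (y * (y - x)) / (x - y) ^+ 2); last by field.
  apply: divr_gt0; last by rewrite exprn_even_gt0.
  by rewrite mulrBr; apply: ltr_wpDl; [exact: sqr_ge0 | rewrite oppr_gt0 mulrC].
move=> h1 h2; have [n1 p1 q1] := ratio _ _ h1; have [n2 p2 q2] := ratio _ _ h2.
split.
  (* [orient c d] is affine along [ab], and this is the point where it vanishes. *)
  exists ((1 - orient c d a / (orient c d a - orient c d b)) *: a +
          (orient c d a / (orient c d a - orient c d b)) *: b); split.
    by exists (orient c d a / (orient c d a - orient c d b)).
  exists (orient a b c / (orient a b c - orient a b d)); split=> //.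
  apply: row2P; rewrite !mxE; move: n1 n2; rewrite /orient => n1 n2;
    by field; rewrite n1 n2.
(* A shared endpoint would make one of the orientations zero. *)
split; apply/eqP => E; move: h1 h2; rewrite E /orient => h1 h2; lra.
Qed.

(** Two successive turns of the same sign make [abcd] a convex chain, whose diagonals are [ac] and
    [bd]. The turns [abd] and [acd] inherit the sign as positive combinations of the given ones. *)
Lemma cross_of_convex_chain {R : realType} (e : R) (s : bool) (a b c d : 'rV[R]_2) :
  shear e a < shear e b -> shear e b < shear e c ->
  shear e c < shear e d ->
  0 < (-1) ^+ s * orient a b c -> 0 < (-1) ^+ s * orient b c d ->
  segments_cross a c b d.
Proof.
move=> ab bc cd abc bcd.
have bc0 : 0 < shear e c - shear e b by rewrite subr_gt0.
have abd : 0 < (-1) ^+ s * orient a b d.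
  rewrite -(pmulr_rgt0 _ bc0).
  rewrite (_ : _ * _ = (shear e d - shear e b) * ((-1) ^+ s * orient a b c)
    + (shear e b - shear e a) * ((-1) ^+ s * orient b c d)).
    by apply: addr_gt0; apply: mulr_gt0 => //; lra.
  by rewrite /orient /shear; ring.
have acd : 0 < (-1) ^+ s * orient a c d.
  rewrite -(pmulr_rgt0 _ bc0).
  rewrite (_ : _ * _ = (shear e d - shear e c) * ((-1) ^+ s * orient a b c)
    + (shear e c - shear e a) * ((-1) ^+ s * orient b c d)).
    by apply: addr_gt0; apply: mulr_gt0 => //; lra.
  by rewrite /orient /shear; ring.
have sgn x y : 0 < (-1) ^+ s * x -> 0 < (-1) ^+ s * y -> - x * y < 0 :> R.
  move=> hx hy; have := mulr_gt0 hx hy.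
  by rewrite mulrACA -expr2 sqrr_sign mul1r mulNr oppr_lt0.
apply: orient_cross.
- rewrite (_ : orient a c b = - orient a b c); first exact: sgn.
  by rewrite /orient; ring.
- rewrite (_ : orient b d c = - orient b c d) 1?mulrC 1?(_ : orient b d a = orient a b d).
  + exact: sgn.
  + by rewrite /orient; ring.
  + by rewrite /orient; ring.
Qed.

(** The points [b] and [c] lie on opposite sides of the line [ad] and in the slab between [a] and
    [d], so [bc] meets that line inside the segment. *)
Lemma cross_of_opposite_sides {R : realType} (e : R) (s : bool) (a b c d : 'rV[R]_2) :
  shear e a < shear e b -> shear e b < shear e c ->
  shear e c < shear e d ->
  0 < (-1) ^+ s * orient a b d -> 0 < (-1) ^+ (~~ s) * orient a c d ->
  segments_cross a d b c.
Proof.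
move=> ab bc cd abd; rewrite signrN mulNr oppr_gt0 => acd.
have ad0 : 0 < shear e d - shear e a by lra.
have abc : 0 < (-1) ^+ s * orient a b c.
  rewrite -(pmulr_rgt0 _ ad0).
  rewrite (_ : _ * _ = (shear e c - shear e a) * ((-1) ^+ s * orient a b d)
    - (shear e b - shear e a) * ((-1) ^+ s * orient a c d)).
    apply: addr_gt0; first by apply: mulr_gt0 => //; lra.
    by rewrite oppr_gt0 pmulr_rlt0 //; lra.
  by rewrite /orient /shear; ring.
have bcd : (-1) ^+ s * orient b c d < 0.
  rewrite -(pmulr_rlt0 _ ad0).
  rewrite (_ : _ * _ = (shear e d - shear e b) * ((-1) ^+ s * orient a c d)
    - (shear e d - shear e c) * ((-1) ^+ s * orient a b d)).
    rewrite -oppr_gt0 opprB; apply: addr_gt0; first by apply: mulr_gt0 => //; lra.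
    by rewrite oppr_gt0 pmulr_rlt0 //; lra.
  by rewrite /orient /shear; ring.
have sgn x y : 0 < (-1) ^+ s * x -> (-1) ^+ s * y < 0 -> x * y < 0 :> R.
  move=> hx hy; have := hy; rewrite -(pmulr_rlt0 _ hx).
  by rewrite mulrACA -expr2 sqrr_sign mul1r.
apply: orient_cross.
- rewrite (_ : orient a d b * _ = orient a b d * orient a c d); first exact: sgn.
  by rewrite /orient; ring.
- rewrite (_ : orient b c a = orient a b c); first exact: sgn.
  by rewrite /orient; ring.
Qed.

(** * An injective shear *)

Lemma exists_injective_shear {R : realType} (P : seq 'rV[R]_2) :
  exists e : R, {in P &, injective (shear e)}.
Proof.
(* Points of different ordinates collide for a single [e], equal to this ratio up to sign, so any
   [e] above all the ratios works. Equal ordinates give the harmless value 0. *)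
pose ratio (p q : 'rV[R]_2) : R := `|(p 0 0 - q 0 0) / (p 0 1 - q 0 1)|.
pose e := 1 + \sum_(p <- P) \sum_(q <- P) ratio p q.
have ratio_lt p q : p \in P -> q \in P -> ratio p q < e.
  move=> pP qP; rewrite /e.
  rewrite (big_rem p pP) /= (big_rem q qP) /=.
  have h1 : 0 <= \sum_(y <- rem q P) ratio p y by apply: sumr_ge0 => ? _; exact: normr_ge0.
  have h2 : 0 <= \sum_(y <- rem p P) \sum_(q0 <- P) ratio y q0.
    by apply: sumr_ge0 => ? _; apply: sumr_ge0 => ? _; exact: normr_ge0.
  lra.
exists e => p q pP qP; rewrite /shear => E.
have [y0|yN0] := eqVneq (p 0 1 - q 0 1) 0.
  have y01 : p 0 1 = q 0 1 by lra.
  by apply: row2P => //; move: E; rewrite y01 => /addIr.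
have := ratio_lt p q pP qP; have := ratio_lt q p qP pP; rewrite /ratio.
rewrite (_ : p 0 0 - q 0 0 = - e * (p 0 1 - q 0 1)); last by lra.
by rewrite mulfK // normrN => _; rewrite ltNge ler_norm.
Qed.

(** * Extrema, quantiles and counting *)

Lemma seq_has_max {R : realType} (s : seq R) (x0 : R) : x0 \in s ->
  exists2 m, m \in s & forall x, x \in s -> x <= m.
Proof.
elim: s x0 => // a [|b s] IH x0 _.
  by exists a => [|x]; rewrite ?mem_head // inE => /eqP->.
have [m ms mM] := IH b (mem_head _ _).
have [am|ma] := leP a m.
  by exists m => [|x]; rewrite inE ?ms ?orbT // => /predU1P[->|/mM].
exists a; first exact: mem_head.
by move=> x; rewrite inE => /predU1P[->//|/mM xm]; apply: le_trans xm (ltW ma).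
Qed.

Lemma seq_has_min {R : realType} (s : seq R) (x0 : R) : x0 \in s ->
  exists2 m, m \in s & forall x, x \in s -> m <= x.
Proof.
move=> x0s; have [|m] := seq_has_max [seq - x | x <- s] (- x0).
  by rewrite map_f.
case/mapP => y ys -> mM; exists y => // x xs.
by rewrite -lerN2; apply: mM; rewrite map_f.
Qed.

Lemma quantile {R : realType} {T : eqType} (f : T -> R) (t : nat) (X : seq T) :
  (0 < t <= size X)%N ->
  exists x, [/\ x \in X, (t <= count (fun y => f y <= f x)%R X)%N
    & (size X - t < count (fun y => f x <= f y)%R X)%N].
Proof.
case/andP=> t0 tX; pose le := fun x y => f x <= f y.
have le_tr : transitive le by move=> ? ? ?; apply: le_trans.
have le_tot : total le by move=> x y; apply: le_total.
have [x0 _] : exists x, x \in X.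
  by case: X tX => [/= ?|x s _]; [lia | exists x; apply: mem_head].
pose S := sort le X; have pS : perm_eq S X by rewrite perm_sort.
have sS : size S = size X by rewrite size_sort.
have srt i j : (i <= j < size X)%N -> le (nth x0 S i) (nth x0 S j).
  move=> h; apply: (sorted_leq_nth le_tr _ x0 (sort_sorted le_tot X)) => //.
  - by move=> x; rewrite /le.
  - by rewrite inE -/S sS; lia.
  - by rewrite inE -/S sS; lia.
  - by lia.
(* The [t]-th smallest entry has index [t - 1]. It is counted on both sides, whence the strict
   inequality. *)
exists (nth x0 S t.-1); split.
- by rewrite -(perm_mem pS) mem_nth // sS; lia.
- rewrite -(permP pS) -[X in (X <= _)%N](@size_takel t _ S); last by rewrite sS.
  rewrite -{3}(cat_take_drop t S) count_cat.
  rewrite (_ : count _ (take t S) = size (take t S)) ?leq_addr //.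
  apply/eqP; rewrite -all_count; apply/(all_nthP x0) => i.
  rewrite size_takel ?sS // => it; rewrite nth_take //.
  by apply: srt; lia.
- rewrite -(permP pS).
  have -> : (size X - t < count (fun y => f (nth x0 S t.-1) <= f y)%R S)%N =
    (size (drop t.-1 S) <= count (fun y => f (nth x0 S t.-1) <= f y)%R S)%N.
    by rewrite size_drop sS; congr leq; lia.
  rewrite -{3}(cat_take_drop t.-1 S) count_cat.
  rewrite (_ : count _ (drop t.-1 S) = size (drop t.-1 S)) ?leq_addl //.
  apply/eqP; rewrite -all_count; apply/(all_nthP x0) => i.
  rewrite size_drop sS => it; rewrite nth_drop.
  by apply: srt; lia.
Qed.

Lemma count_meet {T : eqType} (a b : pred T) (X : seq T) :
  (size X < count a X + count b X)%N -> exists x, [/\ x \in X, a x & b x].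
Proof.
move=> h; have : (0 < count (predI a b) X)%N.
  by have := count_predUI a b X; have := count_size (predU a b) X; lia.
by rewrite -has_count => /hasP[x xX /andP[]]; exists x.
Qed.

(** * A line bisecting two separated sets *)

(** As [m] grows, the comparison flips only at the slope of the line [xz], so finitely many slopes
    are decisive. *)
Lemma height_le {R : realType} (e m : R) (x z : 'rV[R]_2) : shear e x < shear e z ->
  (height e m x <= height e m z) =
  (m <= (z 0 1 - x 0 1) / (shear e z - shear e x)).
Proof.
move=> xz; rewrite ler_pdivlMr ?subr_gt0 // /height mulrBr.
by apply/idP/idP => ?; lra.
Qed.

Lemma sub_in_count {T : eqType} (a b : pred T) (X : seq T) :
  {in X, forall x, a x -> b x} -> (count a X <= count b X)%N.
Proof.
elim: X => //= x X IH ab; apply: leq_add.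
  by case: (a x) (ab x (mem_head _ _)) => // ->.
by apply: IH => y yX; apply: ab; rewrite inE yX orbT.
Qed.

(* With [S m] saying that half of X lies below half of Z along lines of slope m,
   take the largest slope m of a line xz satisfying [S m].  Failure of [S] at the
   next slope yields large parts a of X and b of Z with b below a; since these meet
   the former halves, a single line of slope m bounds all four parts. *)
Lemma balanced_line {R : realType} (e : R) (t : nat) (X Z : seq 'rV[R]_2) :
  (0 < t)%N -> (t.*2 <= size X)%N -> (t.*2 <= size Z)%N ->
  (forall x z, x \in X -> z \in Z -> shear e x < shear e z) ->
  exists m c : R,
    [/\ (t <= count (fun p => height e m p <= c)%R X)%N,
        (t <= count (fun p => c <= height e m p)%R X)%N,
        (t <= count (fun p => height e m p <= c)%R Z)%N
      & (t <= count (fun p => c <= height e m p)%R Z)%N].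
Proof.
move=> t0 tX tZ XZ.
have stX : (0 < t <= size X)%N by lia.
have stZ : (0 < t <= size Z)%N by lia.
have ltn_sub_add n c : (n - t < c -> n < c + t)%N by lia.
have overlap n c c' : (t <= c -> n < c' + t -> n < c + c')%N by lia.
have half n c : (t.*2 <= n -> n < c + t -> t <= c)%N by lia.
pose slope (x z : 'rV[R]_2) : R := (z 0 1 - x 0 1) / (shear e z - shear e x).
have hle m x z : x \in X -> z \in Z ->
    (height e m x <= height e m z) = (m <= slope x z).
  by move=> xX zZ; apply: height_le; apply: XZ.
pose slopes := [seq slope x z | x <- X, z <- Z].
pose S m := has (fun p => (t <= count (fun x => height e m x <= height e m p)%R X)%N
  && (t <= count (fun z => height e m p <= height e m z)%R Z)%N) X.
have [x0 [x0X _ _]] := @quantile R _ (height e 0) t X stX.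
have [z0 [z0Z _ _]] := @quantile R _ (height e 0) t Z stZ.
have [m1 m1s m1min] : exists2 m, m \in slopes & forall m', m' \in slopes -> m <= m'.
  by apply: (seq_has_min _ (slope x0 z0)); apply: allpairs_f.
(* At the least slope, every point of [Z] is at least as high as every point of [X]. *)
have Sm1 : S m1.
  have [x [xX h _]] := @quantile R _ (height e m1) t X stX.
  apply/hasP; exists x => //; rewrite h /=.
  rewrite (_ : count _ Z = size Z); first by lia.
  apply/eqP; rewrite -all_count; apply/allP => z zZ.
  by rewrite hle //; apply: m1min; apply: allpairs_f.
have [m] : exists2 m, m \in filter S slopes &
    forall m', m' \in filter S slopes -> m' <= m.
  by apply: (seq_has_max _ m1); rewrite mem_filter Sm1.
rewrite mem_filter => /andP[Sm _] mM.
have [a [b [aX bZ ab]]] : exists a b : pred 'rV[R]_2,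
    [/\ (size X < count a X + t)%N, (size Z < count b Z + t)%N &
     forall x z, x \in X -> z \in Z -> a x -> b z -> height e m z <= height e m x].
  pose steeper := [seq m' <- slopes | m < m'].
  have [steeper0|[m2 m2s]] : steeper = [::] \/ exists m', m' \in steeper.
    by case: (steeper) => [|m' s]; [left | right; exists m'; apply: mem_head].
    (* If no slope exceeds [m], no point of [Z] is higher than a point of [X]. *)
    exists predT, predT; split; rewrite ?count_predT -?ltn_subLR ?subnn //.
    move=> x z xX zZ _ _; have slm : slope x z <= m.
      rewrite leNgt; apply/negP => lt_m.
      suff : slope x z \in steeper by rewrite steeper0.
      by rewrite mem_filter lt_m allpairs_f.
    move: slm; rewrite /slope ler_pdivrMr ?subr_gt0 ?XZ // mulrBr /height => ?.
    by lra.
  have [m'] := seq_has_min _ _ m2s.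
  rewrite mem_filter => /andP[mm' m's] m'min.
  have NSm' : ~~ S m'.
    by apply/negP => Sm'; move: mm'; rewrite ltNge mM // mem_filter Sm'.
  (* At least [t] points of [X] are no higher than [p], so failure of [S m'] leaves fewer than [t]
     points of [Z] at or above [p]. *)
  have [p [pX p1 p2]] := @quantile R _ (height e m') t X stX.
  exists (fun x => height e m' p <= height e m' x), (fun z => height e m' z < height e m' p).
  split; first by apply: ltn_sub_add p2.
    move/hasPn: NSm' => /(_ p pX); rewrite p1 /= -ltnNge => h.
    have := count_predC (fun z => height e m' p <= height e m' z) Z.
    rewrite (@eq_count _ (predC _) (fun z => height e m' z < height e m' p)); first by lia.
    by move=> z /=; rewrite ltNge.
  move=> x z xX zZ px zp; have slm' : slope x z < m'.
    by rewrite ltNge -hle // -ltNge (lt_le_trans zp px).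
  (* [m'] is the least slope above [m], so a slope below [m'] is at most [m]. *)
  have slm : slope x z <= m.
    rewrite leNgt; apply/negP => lt_m; move: slm'; rewrite ltNge m'min //.
    by rewrite mem_filter lt_m allpairs_f.
  move: slm; rewrite /slope ler_pdivrMr ?subr_gt0 ?XZ // mulrBr /height => ?.
  by lra.
case/hasP: Sm => p pX /andP[pl pu].
exists m, (height e m p); split=> //.
(* Some [z] in [b] is at least as high as [p], and every point of [a] is at least as high as [z]. *)
- have [z [zZ /= pz bz]] := @count_meet _ (fun z => height e m p <= height e m z)
    b Z (overlap _ _ _ pu bZ).
  apply: (@leq_trans (count a X)); first exact: half tX aX.
  by apply: sub_in_count => x xX ax; apply: le_trans pz _; apply: ab.
- have [x [xX /= px ax]] := @count_meet _ (fun x => height e m x <= height e m p)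
    a X (overlap _ _ _ pl aX).
  apply: (@leq_trans (count b Z)); first exact: half tZ bZ.
  by apply: sub_in_count => z zZ bz; apply: le_trans px; apply: ab.
Qed.

(** * Making orientations constant *)

Lemma homogeneous_triple {R : realType} (e : R) (t : nat) (X Y Z : seq 'rV[R]_2) :
  (0 < t)%N -> (t.*2 <= size X)%N -> (t.*2 <= size Y)%N -> (t.*2 <= size Z)%N ->
  (forall x y, x \in X -> y \in Y -> shear e x < shear e y) ->
  (forall y z, y \in Y -> z \in Z -> shear e y < shear e z) ->
  (forall x y z, x \in X -> y \in Y -> z \in Z -> orient x y z != 0) ->
  exists (s : bool) (X' Y' Z' : seq 'rV[R]_2),
    [/\ subseq X' X /\ (t <= size X')%N, subseq Y' Y /\ (t <= size Y')%N,
        subseq Z' Z /\ (t <= size Z')%N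
      & forall x y z, x \in X' -> y \in Y' -> z \in Z' ->
          0 < (-1) ^+ s * orient x y z].
Proof.
move=> t0 tX tY tZ XY YZ oN0.
have [y0 y0Y] : exists y, y \in Y.
  by case: Y tY {XY YZ oN0} => [/= ?|y Y _]; [lia | exists y; apply: mem_head].
have XZ x z : x \in X -> z \in Z -> shear e x < shear e z.
  by move=> xX zZ; apply: lt_trans (XY _ _ xX y0Y) (YZ _ _ y0Y zZ).
have [m [c [Xl Xu Zl Zu]]] := balanced_line e t X Z t0 tX tZ XZ.
have [Yu|Yl] : (t <= count (fun p => c <= height e m p)%R Y)%N \/
    (t <= count (fun p => height e m p <= c)%R Y)%N.
- apply/orP; apply/negPn; rewrite negb_or -!ltnNge; apply/negP => /andP[Yu Yl].
  have : (size Y <= count (fun p => c <= height e m p)%R Y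
     + count (fun p => height e m p <= c)%R Y)%N.
    rewrite -(count_predC (fun p => c <= height e m p)%R Y) leq_add2l.
    by apply: sub_count => p /=; rewrite -ltNge => /ltW.
  have bound n a b : (t.*2 <= n -> a < t -> b < t -> n <= a + b -> False)%N by lia.
  exact: bound tY Yu Yl.
(* With [Y] above level [c] and [X], [Z] below it, [orient_heightE] gives a nonpositive orientation,
   and [oN0] makes it negative. The other case is the mirror image. *)
- exists true, [seq p <- X | height e m p <= c], [seq p <- Y | c <= height e m p],
    [seq p <- Z | height e m p <= c].
  split; rewrite ?filter_subseq ?size_filter //.
  move=> x y z; rewrite !mem_filter => /andP[hx xX] /andP[hy yY] /andP[hz zZ].
  rewrite expr1 mulN1r oppr_gt0 lt_neqAle oN0 //= (orient_heightE e m).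
  have hx' := ler_wpM2l (ltW (_ : 0 < shear e z - shear e y)) hx.
  have hz' := ler_wpM2l (ltW (_ : 0 < shear e y - shear e x)) hz.
  have hy' := ler_wpM2l (ltW (_ : 0 < shear e z - shear e x)) hy.
  have := hx' ltac:(by rewrite subr_gt0 YZ).
  have := hz' ltac:(by rewrite subr_gt0 XY).
  have := hy' ltac:(by rewrite subr_gt0 XZ).
  lra.
- exists false, [seq p <- X | c <= height e m p], [seq p <- Y | height e m p <= c],
    [seq p <- Z | c <= height e m p].
  split; rewrite ?filter_subseq ?size_filter //.
  move=> x y z; rewrite !mem_filter => /andP[hx xX] /andP[hy yY] /andP[hz zZ].
  rewrite expr0 mul1r lt_neqAle eq_sym oN0 //= (orient_heightE e m).
  have hx' := ler_wpM2l (ltW (_ : 0 < shear e z - shear e y)) hx.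
  have hz' := ler_wpM2l (ltW (_ : 0 < shear e y - shear e x)) hz.
  have hy' := ler_wpM2l (ltW (_ : 0 < shear e z - shear e x)) hy.
  have := hx' ltac:(by rewrite subr_gt0 YZ).
  have := hz' ltac:(by rewrite subr_gt0 XY).
  have := hy' ltac:(by rewrite subr_gt0 XZ).
  lra.
Qed.

(** Each triple costs a factor 2. A constant sign passes to subsequences, so later refinements
    preserve the earlier ones. *)
Lemma homogeneous_family {R : realType} (e : R) (n t : nat)
    (ts : seq ('I_n * 'I_n * 'I_n)) (X : 'I_n -> seq 'rV[R]_2) :
  (0 < t)%N -> (forall i, 2 ^ size ts * t <= size (X i))%N ->
  (forall T, T \in ts -> (T.1.1 < T.1.2)%N /\ (T.1.2 < T.2)%N) ->
  (forall (i j : 'I_n) x y, (i < j)%N -> x \in X i -> y \in X j -> shear e x < shear e y) ->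
  (forall (i j k : 'I_n) x y z, (i < j)%N -> (j < k)%N -> x \in X i -> y \in X j -> z \in X k ->
     orient x y z != 0) ->
  exists X' : 'I_n -> seq 'rV[R]_2,
    (forall i, subseq (X' i) (X i) /\ (t <= size (X' i))%N) /\
    forall T, T \in ts -> exists s : bool, forall x y z,
      x \in X' T.1.1 -> y \in X' T.1.2 -> z \in X' T.2 -> 0 < (-1) ^+ s * orient x y z.
Proof.
move=> t0; elim: ts X => [|[[i j] k] ts IH] X sX tsP XX oN0.
  by exists X; split => // l; have := sX l; rewrite mul1n.
have [/= ij jk] := tsP _ (mem_head _ _).
have sX' l : ((2 ^ size ts * t).*2 <= size (X l))%N.
  by have := sX l; rewrite /= expnS -mulnA mul2n.
have [||||s [A [B [C [[sA tA] [sB tB] [sC tC] sgn]]]]] :=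
  homogeneous_triple e (2 ^ size ts * t) (X i) (X j) (X k) _ (sX' i) (sX' j) (sX' k).
- by rewrite muln_gt0 expn_gt0.
- by move=> x y; apply: XX.
- by move=> y z; apply: XX.
- by move=> x y z; apply: oN0.
pose X1 l := if l == i then A else if l == j then B else if l == k then C else X l.
have X1X l : subseq (X1 l) (X l).
  by rewrite /X1; case: eqP => [->//|_]; case: eqP => [->//|_]; case: eqP => [->//|_].
have subX1 l p : p \in X1 l -> p \in X l by apply: mem_subseq.
have [l|T Tts|a b x y ab xa yb|a b c x y z ab bc xa yb zc|X2 [X2P X2sgn]] := IH X1.
- rewrite /X1; do 3 case: eqP => // _.
  by apply: leq_trans (sX' l); rewrite -addnn leq_addr.
- by apply: tsP; rewrite inE Tts orbT.
- by apply: (XX a b) => //; apply: subX1.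
- by apply: (oN0 a b c) => //; apply: subX1.
exists X2; split=> [l|T].
  by have [sl tl] := X2P l; split=> //; apply: subseq_trans sl (X1X l).
rewrite inE => /predU1P[->|]; last exact: X2sgn.
have neq (a b : 'I_n) : (a < b)%N -> (b == a) = false by move=> /gtn_eqF <-.
exists s => x y z /= xi yj zk; apply: sgn.
- by have := mem_subseq (X2P i).1 xi; rewrite /X1 eqxx.
- by have := mem_subseq (X2P j).1 yj; rewrite /X1 eqxx neq.
- by have := mem_subseq (X2P k).1 zk; rewrite /X1 eqxx !neq // (ltn_trans ij jk).
Qed.

(** * Blocks of consecutive points *)

Definition chunk {T : Type} (M : nat) (P : seq T) (j : nat) : seq T :=
  take M (drop (M * j) P).

Lemma size_chunk {T : Type} (M n : nat) (P : seq T) (j : nat) :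
  (M * n <= size P)%N -> (j < n)%N -> size (chunk M P j) = M.
Proof.
move=> MP jn; rewrite size_takel // size_drop.
have : (M * j.+1 <= M * n)%N by rewrite leq_mul2l jn orbT.
by rewrite mulnS; lia.
Qed.

Lemma chunk_subseq {T : eqType} (M : nat) (P : seq T) (j : nat) :
  subseq (chunk M P j) P.
Proof. exact: subseq_trans (take_subseq _ _) (drop_subseq _ _). Qed.

(** Position determines the chunk, so different chunks are disjoint. *)
Lemma index_chunk {T : eqType} (M : nat) (P : seq T) (j : nat) (x : T) :
  uniq P -> x \in chunk M P j -> (index x P %/ M = j)%N.
Proof.
move=> uP xj; have := xj; rewrite -index_mem; set i := index x _ => i_lt.
have [iM iP] : (i < M)%N /\ (i < size P - M * j)%N.
  by apply/andP; move: i_lt; rewrite size_take_min leq_min size_drop.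
have -> : x = nth x P (M * j + i).
  by rewrite -nth_drop -(nth_take x iM) nth_index.
rewrite index_uniq //; last by lia.
by rewrite mulnC divnMDl ?divn_small ?addn0 //; lia.
Qed.

(** * Four crossing sets from five strips *)

Definition crossing_quadruple {R : realType} (P : seq 'rV[R]_2) (t : nat)
    (Q : 'I_4 -> seq 'rV[R]_2) : Prop :=
  [/\ forall l, [/\ uniq (Q l), {subset Q l <= P} & (t <= size (Q l))%N],
      forall l l' p, p \in Q l -> p \in Q l' -> l = l'
    & forall a b c d, a \in Q (inord 0) -> b \in Q (inord 1) ->
        c \in Q (inord 2) -> d \in Q (inord 3) -> segments_cross a b c d].

Lemma four_crossing_sets {R : realType} (P : seq 'rV[R]_2) (t : nat) :
  (0 < t)%N -> (640 * t <= size P)%N -> uniq P ->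
  {in P & &, forall p q r, p != q -> p != r -> q != r -> orient p q r != 0} ->
  exists Q, crossing_quadruple P t Q.
Proof.
move=> t0 tP uP gp.
have [e inj_e] := exists_injective_shear P.
pose le := fun x y : 'rV[R]_2 => shear e x <= shear e y.
have le_tr : transitive le by move=> ? ? ?; apply: le_trans.
have le_tot : total le by move=> x y; apply: le_total.
pose S := sort le P.
have SP p : (p \in S) = (p \in P) by rewrite mem_sort.
have uS : uniq S by rewrite sort_uniq.
(* Five strips of [128 * t] points account for [640 * t]; the factor 128 = [2 ^ 7] pays for seven
   triples. *)
pose X0 (i : 'I_5) := chunk (128 * t) S i.
have X0S i p : p \in X0 i -> p \in S by apply: mem_subseq; apply: chunk_subseq.
have X0_index i p : p \in X0 i -> (index p S %/ (128 * t) = i)%N by apply: index_chunk.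
have X0_size i : (2 ^ 7 * t <= size (X0 i))%N.
  by rewrite (@size_chunk _ _ 5) // size_sort; apply: leq_trans tP; lia.
have X0_shear (i j : 'I_5) x y :
    (i < j)%N -> x \in X0 i -> y \in X0 j -> shear e x < shear e y.
  move=> ij xi yj; have [xS yS] := (X0S _ _ xi, X0S _ _ yj).
  have ixy : (index x S < index y S)%N.
    rewrite ltnNge; apply/negP => /(leq_div2r (128 * t)).
    by rewrite (X0_index _ _ xi) (X0_index _ _ yj) leqNgt ij.
  have le_xy : shear e x <= shear e y.
    have := sorted_leq_index le_tr (fun _ => lexx _) (sort_sorted le_tot P).
    by move=> /(_ x y xS yS (ltnW ixy)).
  rewrite lt_neqAle le_xy andbT; apply/eqP => /inj_e E.
  by move: ixy; rewrite E -?SP // ltnn.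
have neq_shear (x y : 'rV[R]_2) : shear e x < shear e y -> x != y.
  by move=> h; apply: contraTneq h => ->; rewrite ltxx.
have X0_orient (i j k : 'I_5) x y z : (i < j)%N -> (j < k)%N ->
    x \in X0 i -> y \in X0 j -> z \in X0 k -> orient x y z != 0.
  move=> ij jk xi yj zk.
  have xy := X0_shear _ _ _ _ ij xi yj; have yz := X0_shear _ _ _ _ jk yj zk.
  apply: gp; rewrite -?SP ?(X0S _ _ xi) ?(X0S _ _ yj) ?(X0S _ _ zk) ?neq_shear //.
  exact: lt_trans yz.
pose o n : 'I_5 := inord n.
have oE n : (n < 5)%N -> (o n : nat) = n by move=> ?; rewrite inordK.
(* All triples of strips except those containing both the first and the last. *)
pose ts := [:: (o 0, o 1, o 2); (o 0, o 1, o 3); (o 0, o 2, o 3); (o 1, o 2, o 3);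
  (o 1, o 2, o 4); (o 1, o 3, o 4); (o 2, o 3, o 4)]%N.
have ts_incr T : T \in ts -> (T.1.1 < T.1.2)%N /\ (T.1.2 < T.2)%N.
  by rewrite !inE => /or4P[||| /or4P[]] /eqP -> /=; rewrite !oE.
have [X [XX0 Xsgn]] := homogeneous_family e _ t ts X0 t0 X0_size ts_incr X0_shear X0_orient.
have subX i p : p \in X i -> p \in X0 i by apply: mem_subseq; have [] := XX0 i.
have X_shear (i j : 'I_5) x y :
    (i < j)%N -> x \in X i -> y \in X j -> shear e x < shear e y.
  by move=> ij /subX xi /subX yj; apply: X0_shear ij xi yj.
(* [f] lists the strips serving as [Q] 0 to 3: the ends of one segment, then those of the other. *)
have pick (f : seq nat) : uniq f -> size f = 4%N -> all (fun n => n < 5)%N f ->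
    (forall a b c d, a \in X (o (nth 0%N f 0)) -> b \in X (o (nth 0%N f 1)) -> c \in X (o (nth 0%N f 2)) ->
      d \in X (o (nth 0%N f 3)) -> segments_cross a b c d) ->
  exists Q, crossing_quadruple P t Q.
  move=> uf sf f5 cross; exists (fun l => X (o (nth 0%N f l))); split.
  - move=> l; have [sl tl] := XX0 (o (nth 0%N f l)); split=> //.
      by apply: subseq_uniq sl _; apply: subseq_uniq (chunk_subseq _ _ _) uS.
    by move=> p /subX /X0S; rewrite SP.
  - move=> l l' p /subX /X0_index il /subX /X0_index; rewrite il !oE; last 2 first.
    + by apply: (allP f5); rewrite mem_nth // sf.
    + by apply: (allP f5); rewrite mem_nth // sf.
    by move=> /eqP; rewrite nth_uniq ?sf // => /eqP /val_inj.
  - by move=> a b c d; rewrite !inordK //; apply: cross.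
have chain (i j k l : nat) (s : bool) : (i < j < k)%N -> (k < l < 5)%N ->
    (forall x y z, x \in X (o i) -> y \in X (o j) -> z \in X (o k) ->
      0 < (-1) ^+ s * orient x y z) ->
    (forall x y z, x \in X (o j) -> y \in X (o k) -> z \in X (o l) ->
      0 < (-1) ^+ s * orient x y z) ->
  forall a b c d, a \in X (o i) -> b \in X (o k) -> c \in X (o j) ->
    d \in X (o l) -> segments_cross a b c d.
  move=> ijk kl5 h1 h2 a b c d ai bk cj dl.
  apply: (@cross_of_convex_chain _ e s); [| | | exact: h1 | exact: h2].
  + by apply: (X_shear (o i) (o j)); rewrite ?oE //; lia.
  + by apply: (X_shear (o j) (o k)); rewrite ?oE //; lia.
  + by apply: (X_shear (o k) (o l)); rewrite ?oE //; lia.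
have opposite : forall (i j k l : nat) (s s' : bool), (i < j < k)%N -> (k < l < 5)%N ->
    s' != s ->
    (forall x y z, x \in X (o i) -> y \in X (o j) -> z \in X (o l) ->
      0 < (-1) ^+ s * orient x y z) ->
    (forall x y z, x \in X (o i) -> y \in X (o k) -> z \in X (o l) ->
      0 < (-1) ^+ s' * orient x y z) ->
  forall a b c d, a \in X (o i) -> b \in X (o l) -> c \in X (o j) ->
    d \in X (o k) -> segments_cross a b c d.
  move=> i j k l s s' ijk kl5 /negPf ss' h1 h2 a b c d ai bl cj dk.
  have s'E : s' = ~~ s by move: ss'; case: (s) (s') => -[].
  apply: (@cross_of_opposite_sides _ e s); rewrite -?s'E; [| | | exact: h1 | exact: h2].
  + by apply: (X_shear (o i) (o j)); rewrite ?oE //; lia.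
  + by apply: (X_shear (o j) (o k)); rewrite ?oE //; lia.
  + by apply: (X_shear (o k) (o l)); rewrite ?oE //; lia.
have sgn i j k := Xsgn (o i, o j, o k).
have [s012 h012] := sgn 0%N 1%N 2%N (mem_nth (o 0, o 0, o 0)%N (isT : 0 < size ts)%N).
have [s013 h013] := sgn 0%N 1%N 3%N (mem_nth (o 0, o 0, o 0)%N (isT : 1 < size ts)%N).
have [s023 h023] := sgn 0%N 2%N 3%N (mem_nth (o 0, o 0, o 0)%N (isT : 2 < size ts)%N).
have [s123 h123] := sgn 1%N 2%N 3%N (mem_nth (o 0, o 0, o 0)%N (isT : 3 < size ts)%N).
have [s124 h124] := sgn 1%N 2%N 4%N (mem_nth (o 0, o 0, o 0)%N (isT : 4 < size ts)%N).
have [s134 h134] := sgn 1%N 3%N 4%N (mem_nth (o 0, o 0, o 0)%N (isT : 5 < size ts)%N).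
have [s234 h234] := sgn 2%N 3%N 4%N (mem_nth (o 0, o 0, o 0)%N (isT : 6 < size ts)%N).
have [E1|N1] := eqVneq s012 s123.
  by subst s123; apply: (pick [:: 0; 2; 1; 3]%N) => //; apply: chain h012 h123.
have [E2|N2] := eqVneq s123 s234.
  by subst s234; apply: (pick [:: 1; 3; 2; 4]%N) => //; apply: chain h123 h234.
have [E3|N3] := eqVneq s023 s234.
  by subst s234; apply: (pick [:: 0; 3; 2; 4]%N) => //; apply: chain h023 h234.
have [E4|N4] := eqVneq s012 s124.
  by subst s124; apply: (pick [:: 0; 2; 1; 4]%N) => //; apply: chain h012 h124.
have [E5|N5] := eqVneq s013 s134.
  by subst s134; apply: (pick [:: 0; 3; 1; 4]%N) => //; apply: chain h013 h134.
have [E6|N6] := eqVneq s023 s013; last first.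
  by apply: (pick [:: 0; 3; 1; 2]%N) => //; apply: opposite N6 h013 h023.
have [E7|N7] := eqVneq s134 s124; last first.
  by apply: (pick [:: 1; 4; 2; 3]%N) => //; apply: opposite N7 h124 h134.
(* The signs are linked by an odd cycle 013 = 023 <> 234 <> 123 <> 012 <> 124 = 134 <> 013. *)
by clear -N1 N2 N3 N4 N5 E6 E7; destruct s012, s013, s023, s123, s124, s134, s234.
Qed.

(** * Assembling the quadruples of all chunks *)

Theorem theorem1p5 (R : realType) :
  exists eps : nat -> R,
    (forall k : nat, (0 < k)%N ->
       0 < eps k /\
       exists N : nat, forall P : {fset 'rV[R]_2},
         (N <= #|` P|)%N -> general_position P ->
         exists A B : 'I_k -> {fset 'rV[R]_2},
           [/\ forall i, A i `<=` P /\ B i `<=` P,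
               forall i, eps k * (#|` P|)%:R <= (#|` A i|)%:R /\
                         eps k * (#|` P|)%:R <= (#|` B i|)%:R,
               disjoint_families A B
             & reversed_segments_cross A B]) /\
    (exists c : R, 0 < c /\
       forall k : nat, (0 < k)%N -> c / k%:R ^+ 4 <= eps k).
Proof.
exists (fun k => 1280%:R^-1 / k%:R); split; last first.
  exists 1280%:R^-1; split=> [|k k0]; first by rewrite invr_gt0 ltr0n.
  (* The linear bound is stronger than required, as [k <= k ^ 4]. *)
  rewrite ler_pM2l ?invr_gt0 ?ltr0n // lef_pV2 ?posrE ?exprn_gt0 ?ltr0n //.
  by rewrite -natrX ler_nat -[X in (X <= _)%N]expn1 leq_pexp2l.
move=> k k0; split; first by rewrite divr_gt0 ?invr_gt0 ?ltr0n.
exists (640 * k)%N => P nP gp.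
pose t := (#|` P| %/ (640 * k))%N.
have t0 : (0 < t)%N by rewrite divn_gt0 // muln_gt0.
have tP : (640 * t * k <= size P)%N.
  by rewrite mulnAC mulnC leq_divM.
(* Since [t >= 1], rounding down loses at most a factor 2: [#|P| < 640 k (t + 1) <= 1280 k t]. *)
have epsP n : (t <= n)%N -> 1280%:R^-1 / k%:R * (#|` P|)%:R <= n%:R :> R.
  move=> tn; rewrite -invfM -natrM mulrC ler_pdivrMr ?ltr0n ?muln_gt0 //.
  rewrite -natrM ler_nat.
  have := ltn_ceil #|` P| (_ : 0 < 640 * k)%N; rewrite muln_gt0 -/t => /(_ k0).
  nia.
have uP : uniq P := fset_uniq P.
pose C := chunk (640 * t) P.
have CP j p : p \in C j -> p \in P by apply: mem_subseq; apply: chunk_subseq.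
have /choice[Q QP] (j : 'I_k) : exists Q, crossing_quadruple (C j) t Q.
  apply: four_crossing_sets => //.
  - by rewrite (@size_chunk _ _ k).
  - exact: subseq_uniq (chunk_subseq _ _ _) uP.
  - move=> p q r /CP pP /CP qP /CP rP; exact: orient_neq0 gp pP qP rP.
have Qinj j j' l l' p : p \in Q j l -> p \in Q j' l' -> j = j' /\ l = l'.
  have [Qj Qll _] := QP j; have [Qj' _ _] := QP j'.
  move=> pj pj'; have [_ /(_ p pj) + _] := Qj l; have [_ /(_ p pj') + _] := Qj' l'.
  move=> /(index_chunk _ _ _ _ uP) Ej /(index_chunk _ _ _ _ uP) Ej'.
  have jj' : j = j' by apply: val_inj; rewrite /= -Ej -Ej'.
  by subst j'; split=> //; apply: Qll pj pj'.
(* The quadruple in chunk i serves the two indices i and [rev_ord i]. *)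
pose near (i : 'I_k) := if (i < rev_ord i)%N then i else rev_ord i.
(* For [i < rev_ord i], the sets [A i], [B (rev_ord i)], [A (rev_ord i)], [B i] are [Q] 0, 1, 2, 3
   in this order. *)
pose la (i : 'I_k) : 'I_4 := if (i < rev_ord i)%N then inord 0 else inord 2.
pose lb (i : 'I_k) : 'I_4 := if (i < rev_ord i)%N then inord 3 else inord 1.
have labN i j : la i != lb j.
  by rewrite /la /lb -val_eqE /=; do 2 case: ifP => _; rewrite !inordK.
have near_inj i j : near i = near j -> i = j \/ i = rev_ord j.
  rewrite /near; case: ifP => _; case: ifP => _ E; try by [left | right].
  - by right; rewrite -E rev_ordK.
  - by left; apply: rev_ord_inj.
have rev_lt (i : 'I_k) : i != rev_ord i ->
    (rev_ord i < rev_ord (rev_ord i))%N = ~~ (i < rev_ord i)%N.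
  move=> iN; have iN' : (i : nat) != rev_ord i := iN.
  by rewrite rev_ordK -leqNgt ltn_neqAle eq_sym iN'.
have laJ i : i != rev_ord i -> la i != la (rev_ord i).
  move=> iN; rewrite /la rev_lt //; case: ifP => _ /=; rewrite -val_eqE /= !inordK //.
have lbJ i : i != rev_ord i -> lb i != lb (rev_ord i).
  move=> iN; rewrite /lb rev_lt //; case: ifP => _ /=; rewrite -val_eqE /= !inordK //.
pose F j l := [fset p in Q j l].
have inF j l p : (p \in F j l) = (p \in Q j l) by rewrite inE.
have sF j l : F j l `<=` P.
  apply/fsubsetP => p; rewrite inF => pQ.
  by have [/(_ l)[_ /(_ p pQ)] /CP] := QP j.
have cF j l : 1280%:R^-1 / k%:R * (#|` P|)%:R <= (#|` F j l|)%:R :> R.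
  by have [/(_ l)[uQ _ tQ] _ _] := QP j; apply: epsP; rewrite card_fseq undup_id.
have dF j l j' l' : (j = j' -> l != l') -> [disjoint F j l & F j' l'].
  move=> jl; apply/fdisjointP => p; rewrite !inF => pj; apply/negP => pj'.
  by have [jj' ll'] := Qinj _ _ _ _ _ pj pj'; move: (jl jj'); rewrite ll' eqxx.
exists (fun i => F (near i) (la i)), (fun i => F (near i) (lb i)); split=> //.
- split=> i j.
  (* Distinct indices share a chunk only when mirrored, and then take different members of its
     quadruple. *)
  + move=> ij; apply: dF => /near_inj[E|E]; first by rewrite E eqxx in ij.
    by move: ij; rewrite E eq_sym => /laJ; rewrite eq_sym.
  + move=> ij; apply: dF => /near_inj[E|E]; first by rewrite E eqxx in ij.
    by move: ij; rewrite E eq_sym => /lbJ; rewrite eq_sym.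
  + by apply: dF => _; apply: labN.
- move=> i iN a b a' b'; rewrite !inF /near /la /lb rev_lt // rev_ordK.
  case: ifP => _ /=; [have [_ _ cross] := QP i | have [_ _ cross] := QP (rev_ord i)].
  + by move=> ha hb ha' hb'; apply: cross ha hb ha' hb'.
  (* For the larger index of a mirrored pair the two segments swap roles. *)
  + by move=> ha hb ha' hb'; apply/segments_crossC; apply: cross ha' hb' ha hb.
Qed.
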